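(* Let $d\in\mathbb{N}$ and $p\in\mathcal{D}_d$. If $k\to\infty$ and $b\to\infty$ ($k,b$ positive integers), then $\min_{q\in\widetilde{\mathcal{H}}_{d,b}^k}\|p-q\|_1\to 0$.
   Context: $\mathbb{N}$ denotes the positive integers and $[b]=\{1,\ldots,b\}$. $\mathcal{D}_d$ is the set of all probability densities on $[0,1)^d$ (with respect to $d$-dimensional Lebesgue measure); $\|\cdot\|_1$ is the $L^1$ norm. $\mathcal{T}_{d,k}$ is the set of order-$d$ tensors $W\in\mathbb{R}^{k\times\cdots\times k}$ ($d$ modes, indexed by $[k]^d$) with nonnegative entries summing to one. For $i\in[b]$, let $h_{1,b,i}(x)=b\,\mathbf{1}\left(\frac{i-1}{b}\le x<\frac{i}{b}\right)$ on $[0,1)$, and let $\mathcal{H}_{1,b}$ be the convex hull of $\{h_{1,b,i}: i\in[b]\}$. For univariate functions, $\prod_{j=1}^d p_j$ denotes $(x_1,\ldots,x_d)\mapsto\prod_{j=1}^d p_j(x_j)$. The set of Tucker histograms is $$\widetilde{\mathcal{H}}_{d,b}^k=\left\{\sum_{S\in[k]^d}W_S\prod_{i=1}^d p_{i,S_i}\;:\;W\in\mathcal{T}_{d,k},\ p_{i,j}\in\mathcal{H}_{1,b}\right\}.$$ *)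

(* Defs.v *)
From HB Require Import structures.
From mathcomp Require Import all_boot all_order all_algebra.
From mathcomp Require Import all_classical all_reals all_analysis.

Set Implicit Arguments.
Unset Strict Implicit.
Unset Printing Implicit Defensive.

Import Order.TTheory GRing.Theory Num.Theory.
Import numFieldNormedType.Exports.

Local Open Scope classical_set_scope.
Local Open Scope ring_scope.

(* R^d with its Borel sigma-algebra: the library equips tuples with the
   product sigma-algebra. *)
Notation Rspace R d := (d.-tuple (measurableTypeR R)).

(* The library has binary product measures but no d-dimensional Lebesgue
   measure. It is defined here as the d-fold product of the one-dimensional
   one, transported along (x, t) |-> x :: t. It is sigma-finite and gives
   boxes their volume (lebesgue_measureR_box), which determines it. *)
Fixpoint lebesgue_measureR (R : realType) (d : nat) :
    set (Rspace R d) -> \bar R :=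
  match d with
  | 0 => \d_([tuple] : Rspace R 0)
  | d'.+1 => pushforward (lebesgue_measure \x @lebesgue_measureR R d')%E
      (fun z : measurableTypeR R * Rspace R d' =>
         [tuple of z.1 :: z.2] : Rspace R d'.+1)
  end.
Arguments lebesgue_measureR : clear implicits.

Section lebesgue_measureR.
Context {R : realType}.

Let cons_tuple d (z : measurableTypeR R * Rspace R d) : Rspace R d.+1 :=
  [tuple of z.1 :: z.2].

Let measurable_cons_tuple d : measurable_fun setT (@cons_tuple d).
Proof. exact: measurable_cons. Qed.

Let is_sigma_finite_measure d (m : set (Rspace R d) -> \bar R) :=
  [/\ m set0 = 0%E, forall A, (0 <= m A)%E,
      semi_sigma_additive m & sigma_finite setT m].

Let cons_measure d (m : {sigma_finite_measure set (Rspace R d) -> \bar R}) :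
  is_sigma_finite_measure
    (pushforward (lebesgue_measure \x m)%E (@cons_tuple d)).
Proof.
split.
- by rewrite /pushforward preimage_set0 measure0.
- by move=> A; apply: integral_ge0.
- by apply: measure_semi_sigma_additive => //; exact: measurable_cons_tuple.
- have /sigma_finiteP[F [FT ndF Foo]] := sigma_finiteT (@lebesgue_measure R).
  have /sigma_finiteP[G [GT ndG Goo]] := sigma_finiteT m.
  exists (fun n => [set t : Rspace R d.+1 | F n (thead t) /\ G n [tuple of behead t]]).
    apply/seteqP; split=> // t _.
    have [j _ Fj] : (\bigcup_j F j) (thead t) by rewrite -FT.
    have [l _ Gl] : (\bigcup_l G l) [tuple of behead t] by rewrite -GT.
    exists (maxn j l) => //; split.
      by move: (thead t) Fj; exact/subsetPset/ndF/leq_maxl.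
    by move: [tuple of behead t] Gl; exact/subsetPset/ndG/leq_maxr.
  move=> n; have [mF Fn] := Foo n; have [mG Gn] := Goo n; split.
    rewrite (_ : [set _ | _] = (fun t => tnth t ord0) @^-1` F n `&`
      (fun t : Rspace R d.+1 => [tuple of behead t]) @^-1` G n)//.
    apply: measurableI; rewrite -[X in measurable X]setTI.
      exact: measurable_tnth.
    exact: measurable_behead.
  rewrite /pushforward (_ : _ @^-1` _ = F n `*` G n).
    by rewrite product_measure1E// lte_mul_pinfty// ge0_fin_numE.
  apply/seteqP; split => -[x t] /=; rewrite theadE/=;
    by rewrite (_ : [tuple of behead (x :: t)] = t)//; exact/val_inj.
Qed.

Let lebesgue_measureRP d : is_sigma_finite_measure (lebesgue_measureR R d).
Proof.
elim: d => [|d [m0 mge0 madd mfin]].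
  split; [exact: measure0|by move=> A; exact: measure_ge0|
          exact: measure_semi_sigma_additive|exact: sigma_finiteT].
pose m : measure (Rspace R d) R :=
  HB.pack (lebesgue_measureR R d) (isMeasure.Build _ _ _ _ m0 mge0 madd).
pose ms : {sigma_finite_measure set (Rspace R d) -> \bar R} :=
  HB.pack (lebesgue_measureR R d) (isMeasure.Build _ _ _ _ m0 mge0 madd)
    (Measure_isSigmaFinite.Build _ _ _ m mfin).
exact: (cons_measure ms).
Qed.

Let lebesgue_measureR0 d : lebesgue_measureR R d set0 = 0%E.
Proof. by have [] := lebesgue_measureRP d. Qed.

Let lebesgue_measureR_ge0 d A : (0 <= lebesgue_measureR R d A)%E.
Proof. by have [_ /(_ A)] := lebesgue_measureRP d. Qed.

Let lebesgue_measureR_sigma_additive d :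
  semi_sigma_additive (lebesgue_measureR R d).
Proof. by have [] := lebesgue_measureRP d. Qed.

Let lebesgue_measureR_sigma_finite d :
  sigma_finite setT (lebesgue_measureR R d).
Proof. by have [] := lebesgue_measureRP d. Qed.

HB.instance Definition _ d := isMeasure.Build _ _ _ (lebesgue_measureR R d)
  (@lebesgue_measureR0 d) (@lebesgue_measureR_ge0 d)
  (@lebesgue_measureR_sigma_additive d).

HB.instance Definition _ d :=
  Measure_isSigmaFinite.Build _ _ _ (lebesgue_measureR R d)
    (@lebesgue_measureR_sigma_finite d).

Lemma lebesgue_measureR_box d (A : 'I_d -> set (measurableTypeR R)) :
  (forall i, measurable (A i)) ->
  lebesgue_measureR R d [set t | forall i, A i (tnth t i)] =
  (\prod_(i < d) lebesgue_measure (A i))%E.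
Proof.
elim: d A => [|d IH] A mA.
  by rewrite big_ord0 /= diracE mem_set// => -[].
have mB : measurable [set t : Rspace R d | forall i, A (lift ord0 i) (tnth t i)].
  rewrite (_ : [set _ | _] = \bigcap_(i in [set: 'I_d])
      ((fun t : Rspace R d => tnth t i) @^-1` A (lift ord0 i))).
    apply: fin_bigcap_measurable => // i _; rewrite -[X in measurable X]setTI.
    exact: measurable_tnth.
  by apply/seteqP; split => t h i; [move=> _|]; apply: h.
rewrite big_ord_recl -IH// -product_measure1E//= /pushforward.
congr (_ \x _)%E.
apply/seteqP; split => -[x t] /=.
  move=> h; split; first exact: (h ord0).
  by move=> i; move: (h (lift ord0 i)); rewrite tnthS.
by move=> [h0 h] i; case: (unliftP ord0 i) => [j ->|->//]; rewrite tnthS.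
Qed.

End lebesgue_measureR.

Section tucker_histograms.
Variable R : realType.

Definition unit_cube (d : nat) : set (Rspace R d) :=
  [set x | forall i, 0 <= (tnth x i : R) < 1].

(* Functions on [0,1)^d are represented by functions on R^d of which only the
   values on [0,1)^d are used. *)
Definition is_density (d : nat) (p : Rspace R d -> R) :=
  [/\ measurable_fun (@unit_cube d) p,
      forall x, unit_cube x -> 0 <= p x &
      (\int[lebesgue_measureR R d]_(x in @unit_cube d) (p x)%:E = 1)%E].

Definition L1_dist (d : nat) (p q : Rspace R d -> R) : \bar R :=
  ('N[lebesgue_measureR R d]_1
     [EFin \o ((fun x => p x - q x)%R \_ (@unit_cube d))])%E.

(* 0-based: [hist_bin b i] is h_{1,b,i+1}. *)
Definition hist_bin (b : nat) (i : 'I_b) : R -> R :=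
  fun x => b%:R * \1_(`[i%:R / b%:R, i.+1%:R / b%:R[) x.

Definition convex_hull (E : lmodType R) (A : set (convex_lmodType E)) :=
  smallest (@convex_set R E) A.

Definition hist1 (b : nat) : set (R -> R) :=
  @convex_hull (R -> R) (range (@hist_bin b)).

Definition prob_tensor (d k : nat) : set (d.-tuple 'I_k -> R) :=
  [set W | (forall S, 0 <= W S) /\ \sum_S W S = 1].

Definition tucker_histogram (d b k : nat) : set (Rspace R d -> R) :=
  [set q | exists W : d.-tuple 'I_k -> R,
           exists p : 'I_d -> 'I_k -> R -> R,
    [/\ prob_tensor W, forall i j, hist1 b (p i j) &
        q = fun x =>
          \sum_(S : d.-tuple 'I_k) W S * \prod_(i < d) p i (tnth S i) (tnth x i)]].

End tucker_histograms.

Arguments unit_cube : clear implicits.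
Arguments tucker_histogram : clear implicits.

Definition is_minimum (R : realType) (A : set (\bar R)) (m : \bar R) :=
  A m /\ lbound A m.

(* Main.v *)
Require Import Defs.
From mathcomp Require Import all_boot all_order all_algebra.
From mathcomp Require Import all_classical all_reals all_analysis.
From mathcomp Require Import measurable_realfun ring lra.

Import Order.TTheory GRing.Theory Num.Theory.
Import numFieldNormedType.Exports.
Import HBSimple.

Local Open Scope classical_set_scope.
Local Open Scope ring_scope.

(** Write [E_n f] for the function that is constant on each cell of the regular
grid of [n ^ d] cells of the cube, with value the mean of [f] on that cell.

Two facts carry the convergence. The first is that [E_n f] tends to [f] in
[L^1]. A mean is at most twice as far from [f] as any constant is, so it
suffices that [f] can be approximated by some function constant on the cells of
the grid of size [n], for every large [n] ([grid_approx_integrable]). The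
functions with this property are stable under Lipschitz operations and [L^1]
limits ([grid_approx_lipschitz], [grid_approx_lim]); hence the sets whose
indicator has it form a sigma-algebra. Half-spaces [x_i < a] belong to it, as
only the slab of cells met by the hyperplane, of volume [1 / n], matters
([grid_approx_halfspace]). So all measurable sets, simple functions and
integrable functions follow.

The second fact is that [E_b (E_k p)] is a Tucker histogram whatever the
relative size of [k] and [b]: [E_k p] is a mixture of products of the histogram
densities of [k] bins, and [E_b] of a product is the product of the
one-dimensional averages, which are histograms with [b] bins
([tucker_coef_cell_mean]). As [E_b] is a contraction, the distance from [p] to
[E_b (E_k p)] is controlled by the approximability of [p] on the two grids
separately ([dist_cell_mean]).

The minimum exists because a Tucker histogram is determined by its core tensor
and its mixing weights, which range over a compact product of simplices, and
the distance to [p] is a continuous function of them: it is a sum over cells of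
[L^1] distances from [p] to constants that are polynomial in the parameters
([tucker_dist_min]). *)

(** * Real-valued L1 distances *)

Section L1.
Context {d} {T : measurableType d} {R : realType}.
Variable mu : {measure set T -> \bar R}.
Implicit Types (A : set T) (f g h : T -> R).

Local Notation integrableR A f := (mu.-integrable A (EFin \o f)).

Lemma integrableR_cst A (c : R) : measurable A -> (mu A < +oo)%E ->
  integrableR A (fun=> c).
Proof.
move=> mA muA; apply: measurable_bounded_integrable => //.
exact: bounded_cst.
Qed.

Lemma integrableRB A f g : measurable A -> integrableR A f ->
  integrableR A g -> integrableR A (fun x => f x - g x).
Proof. by move=> mA If Ig; have := integrableB mA If Ig; apply. Qed.

Lemma integrableR_dist A f g : measurable A -> integrableR A f ->
  integrableR A g -> integrableR A (fun x => `|f x - g x|).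
Proof. by move=> mA If Ig; exact/integrable_norm/integrableRB. Qed.

Lemma Rintegral_dist_triangle A f g h : measurable A ->
  integrableR A f -> integrableR A g -> integrableR A h ->
  \int[mu]_(x in A) `|f x - h x| <=
  \int[mu]_(x in A) `|f x - g x| + \int[mu]_(x in A) `|g x - h x|.
Proof.
move=> mA If Ig Ih; rewrite -RintegralD//; try exact: integrableR_dist.
apply: le_Rintegral => //; first exact: integrableR_dist.
  by have := integrableD mA (integrableR_dist _ _ _ mA If Ig)
    (integrableR_dist _ _ _ mA Ig Ih); apply.
by move=> x _; exact: ler_distD.
Qed.

(** Compare both [f] and the mean [m] of [g] with [c]. The distance from [c] to
[m] is the modulus of the integral of [c - g], hence at most the distance from
[c] to [g], and thus to [f] plus the one from [f] to [g]. *)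
Lemma Rintegral_dist_mean A f g (c : R) : measurable A ->
  fine (mu A) != 0 -> integrableR A f -> integrableR A g ->
  \int[mu]_(x in A) `|f x - (fine (mu A))^-1 * \int[mu]_(x in A) g x| <=
  2 * \int[mu]_(x in A) `|f x - c| + \int[mu]_(x in A) `|f x - g x|.
Proof.
move=> mA muA0 If Ig.
have muA : (mu A < +oo)%E.
  by move: muA0; case: (mu A) => [r||] //=; rewrite ?ltry ?eqxx.
have Ic r : integrableR A (fun=> r) by exact: integrableR_cst.
set m := _^-1 * _.
have cm : \int[mu]_(x in A) `|c - m| <= \int[mu]_(x in A) `|c - g x|.
  rewrite Rintegral_cst//.
  have -> : `|c - m| * fine (mu A) = `|\int[mu]_(x in A) (c - g x)|.
    rewrite RintegralB// Rintegral_cst//.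
    rewrite -[X in _ * X]ger0_norm ?fine_ge0// -normrM mulrBl /m.
    by rewrite mulrAC mulVf// mul1r.
  by apply: le_normr_Rintegral => //; exact: integrableRB.
have fm := Rintegral_dist_triangle A f (fun=> c) (fun=> m) mA If (Ic c) (Ic m).
have cg := Rintegral_dist_triangle A (fun=> c) f g mA (Ic c) If Ig.
have E : \int[mu]_(x in A) `|c - f x| = \int[mu]_(x in A) `|f x - c|.
  by apply: eq_Rintegral => x _; rewrite distrC.
rewrite E in cg; lra.
Qed.

End L1.

(** * The regular grid of the unit cube *)

Section grid.
Context {R : realType}.

Definition bin (n i : nat) : set R := `[i%:R / n%:R, i.+1%:R / n%:R[.

Lemma bin_subset01 n i : (i < n)%N -> bin n i `<=` `[0, 1[.
Proof.
move=> iN x; rewrite /bin /= !in_itv/= => /andP[x0 x1].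
have n0 : (0 < n%:R :> R) by rewrite ltr0n (leq_ltn_trans _ iN).
rewrite (le_trans _ x0) ?divr_ge0//=; apply: (lt_le_trans x1).
by rewrite ler_pdivrMr// mul1r ler_nat.
Qed.

Lemma bin_inj n i j x : (0 < n)%N -> bin n i x -> bin n j x -> i = j.
Proof.
move=> n0; rewrite /bin /= !in_itv/=.
have n0' : (0 < n%:R :> R) by rewrite ltr0n.
rewrite !ler_pdivrMr// !ltr_pdivlMr// => /andP[a b] /andP[c e].
apply/eqP; rewrite eqn_leq; apply/andP; split.
  by rewrite -ltnS -(ltr_nat R) (le_lt_trans a).
by rewrite -ltnS -(ltr_nat R) (le_lt_trans c).
Qed.

Lemma bin_exists n x : (0 < n)%N -> 0 <= x < 1 -> exists i : 'I_n, bin n i x.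
Proof.
move=> n0 /andP[x0 x1].
have n0' : (0 < n%:R :> R) by rewrite ltr0n.
have nx : 0 <= x * n%:R by rewrite mulr_ge0.
have /andP[lo up] := truncn_itv nx.
have lt : (Num.truncn (x * n%:R) < n)%N.
  by rewrite -(ltr_nat R) (le_lt_trans lo)// gtr_pMl.
exists (Ordinal lt); rewrite /bin /= in_itv/= ler_pdivrMr// ltr_pdivlMr//.
by rewrite lo.
Qed.

Lemma lebesgue_measure_bin n i : (0 < n)%N ->
  lebesgue_measure (bin n i) = (n%:R^-1)%:E.
Proof.
move=> n0; have n0' : (0 < n%:R :> R) by rewrite ltr0n.
rewrite /bin lebesgue_measure_itv/= lte_fin ltr_pM2r ?invr_gt0// ltr_nat ltnSn.
by rewrite -EFinB -mulrBl -natrB// subSnn mul1r.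
Qed.

Context {d : nat}.
Local Notation mu := (lebesgue_measureR R d).
Local Notation D := (unit_cube R d).

Lemma measurable_box (A : 'I_d -> set (measurableTypeR R)) :
  (forall i, measurable (A i)) ->
  measurable [set t : Rspace R d | forall i, A i (tnth t i)].
Proof.
move=> mA; rewrite (_ : [set _ | _] = \bigcap_(i in [set: 'I_d])
    ((fun t : Rspace R d => tnth t i) @^-1` A i)).
  apply: fin_bigcap_measurable => // i _; rewrite -[X in measurable X]setTI.
  exact: measurable_tnth.
by apply/seteqP; split => t h i; [move=> _|]; apply: h.
Qed.

Lemma unit_cubeE : D = [set t | forall i, `[0, 1[%classic (tnth t i : R)].
Proof. by apply/seteqP; split => t h i; have := h i; rewrite /= in_itv. Qed.

Lemma measurable_unit_cube : measurable D.
Proof.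
rewrite unit_cubeE; apply: (measurable_box (fun=> `[0, 1[%classic)) => i.
exact: measurable_itv.
Qed.

Lemma mu_unit_cube : mu D = 1%E.
Proof.
rewrite unit_cubeE (lebesgue_measureR_box (A := fun=> `[0, 1[%classic)).
  rewrite big1// => i _.
  by rewrite lebesgue_measure_itv/= lte_fin ltr01 oppr0 adde0.
by move=> i; exact: measurable_itv.
Qed.

Lemma mu_unit_cube_lty : (mu D < +oo)%E.
Proof. by rewrite mu_unit_cube ltry. Qed.

Lemma integrable_indic_cube (A : set (Rspace R d)) : measurable A ->
  mu.-integrable D (EFin \o (\1_A : Rspace R d -> R)).
Proof.
move=> mA; apply: measurable_bounded_integrable.
- exact: measurable_unit_cube.
- exact: mu_unit_cube_lty.
- exact: measurable_indic.
- exists 1; split => // M M1 x _ /=; rewrite indicE.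
  by case: (_ \in _) => /=; rewrite ?normr1 ?normr0 ltW// (lt_trans _ M1).
Qed.

Definition cell n (S : d.-tuple 'I_n) : set (Rspace R d) :=
  [set x | forall j, bin n (tnth S j) (tnth x j)].

(** On the cube this is the function with value [c S] on the cell [S]: the sum
has at most one nonzero term ([stepE]). *)
Definition step n (c : d.-tuple 'I_n -> R) (x : Rspace R d) : R :=
  \sum_S c S * \1_(cell n S) x.

Lemma measurable_cell n S : measurable (cell n S).
Proof.
apply: (measurable_box (fun j => bin n (tnth S j))) => i.
exact: measurable_itv.
Qed.

Lemma cell_inj n S S' x : (0 < n)%N -> cell n S x -> cell n S' x -> S = S'.
Proof.
move=> n0 h h'; apply: eq_from_tnth => j; apply/val_inj.
exact: bin_inj (h j) (h' j).
Qed.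

Lemma cell_exists n x : (0 < n)%N -> D x -> exists S, cell n S x.
Proof.
move=> n0 Dx; have /choice[s hs] j := bin_exists n (tnth x j) n0 (Dx j).
by exists [tuple s j | j < d] => j; rewrite tnth_mktuple; exact: hs.
Qed.

Lemma cell_subset n S : cell n S `<=` D.
Proof.
move=> x h; rewrite unit_cubeE => j.
exact: (bin_subset01 _ _ (ltn_ord (tnth S j))).
Qed.

Lemma mu_cell n S : (0 < n)%N -> mu (cell n S) = (n%:R ^- d)%:E.
Proof.
move=> n0; rewrite (lebesgue_measureR_box (A := fun j => bin n (tnth S j)));
  last by move=> i; exact: measurable_itv.
under eq_bigr do rewrite lebesgue_measure_bin//.
by rewrite prodEFin prodr_const card_ord exprVn.
Qed.

Lemma stepE n c S x : (0 < n)%N -> cell n S x -> step n c x = c S.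
Proof.
move=> n0 Sx; rewrite /step (bigD1 S)//= big1 ?addr0.
  by rewrite indicE mem_set// mulr1.
move=> S' nS; rewrite indicE memNset ?mulr0// => S'x.
by move/eqP: nS; apply; exact: cell_inj S'x Sx.
Qed.

Lemma unit_cube_bigcup n : (0 < n)%N ->
  D = \big[setU/set0]_(S <- index_enum {: d.-tuple 'I_n}) cell n S.
Proof.
move=> n0; rewrite -bigcup_seq; apply/seteqP; split => x.
  by move=> /(cell_exists _ _ n0)[S Sx]; exists S => //=; rewrite mem_index_enum.
by move=> [S _]; exact: cell_subset.
Qed.

Lemma Rintegral_cells n f : (0 < n)%N -> mu.-integrable D (EFin \o f) ->
  \int[mu]_(x in D) f x = \sum_S \int[mu]_(x in cell n S) f x.
Proof.
move=> n0 If; rewrite /Rintegral [in LHS](unit_cube_bigcup _ n0).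
have IS S : mu.-integrable (cell n S) (EFin \o f).
  apply: integrableS If => //; [exact: measurable_unit_cube|exact: measurable_cell|].
  exact: cell_subset.
rewrite integral_bigsetU_EFin//.
- rewrite (eq_bigr (fun S => (\int[mu]_(x in cell n S) f x)%:E)) ?sumEFin// => S _.
  by rewrite fineK//; apply: integrable_fin_num => //; exact: measurable_cell.
- by move=> S; exact: measurable_cell.
- exact: index_enum_uniq.
- apply/trivIsetP => S S' _ _ /eqP SS'; rewrite -subset0 => x [h h'].
  exact/SS'/(cell_inj _ _ _ _ n0 h h').
- by rewrite -unit_cube_bigcup//; case/integrableP: If.
Qed.

Lemma integrable_step n c : (0 < n)%N -> mu.-integrable D (EFin \o step n c).
Proof.
move=> n0; have -> : EFin \o step n c =
    fun x => (\sum_S (c S * \1_(cell n S) x)%:E)%E.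
  by apply/funext => x; rewrite sumEFin.
apply: integrable_sum; first exact: measurable_unit_cube.
move=> S _; apply: (@integrableZl _ _ _ mu _ measurable_unit_cube (c S)
  (fun x => (\1_(cell n S) x)%:E)).
exact: (integrable_indic_cube _ (measurable_cell n S)).
Qed.

End grid.

(** * Approximation by functions constant on grid cells *)

Section grid_approx.
Context {R : realType} {d : nat}.
Local Notation mu := (lebesgue_measureR R d).
Local Notation D := (unit_cube R d).
Local Notation mD := (@measurable_unit_cube R d).
Implicit Types (f g h : Rspace R d -> R) (A : set (Rspace R d)).

Local Notation integrable_cube f := (mu.-integrable D (EFin \o f)).

(** Approximability is required on every fine enough grid, not on some sequence
of grids: this makes the class closed under sums and maxima without common
refinements, and is what the independence of [k] and [b] calls for. *)
Definition grid_approx f := forall e : R, 0 < e -> exists N, forall n,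
  (N <= n)%N -> (0 < n)%N ->
  exists c : d.-tuple 'I_n -> R, \int[mu]_(x in D) `|f x - step n c x| < e.

(** Apply the operation to the values of the approximants on each cell. The
statement covers complements, maxima, sums and scalings at once. *)
Lemma grid_approx_lipschitz (op : R -> R -> R) (K : R) f g h :
  (forall a b a' b', `|op a b - op a' b'| <= K * (`|a - a'| + `|b - b'|)) ->
  integrable_cube f -> integrable_cube g -> integrable_cube h ->
  (forall x, D x -> f x = op (g x) (h x)) ->
  grid_approx g -> grid_approx h -> grid_approx f.
Proof.
move=> opK If Ig Ih fE Ag Ah e e0.
have K0 : 0 <= K.
  have := opK 0 0 1 0; rewrite subrr normr0 addr0 sub0r normrN1 mulr1.
  exact: le_trans.
(* [K + 1] instead of [K], since [K] may vanish *)
have e'0 : 0 < e / (2 * (K + 1)) by rewrite divr_gt0// mulr_gt0// ltr_wpDl.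
have [N1 H1] := Ag _ e'0; have [N2 H2] := Ah _ e'0.
exists (maxn N1 N2) => n; rewrite geq_max => /andP[n1 n2] n0.
have [c1 h1] := H1 n n1 n0; have [c2 h2] := H2 n n2 n0.
have I1 := integrableR_dist mu _ _ _ mD Ig (integrable_step n c1 n0).
have I2 := integrableR_dist mu _ _ _ mD Ih (integrable_step n c2 n0).
exists (fun S => op (c1 S) (c2 S)).
have I12 := integrableD mD I1 I2.
have I12K := integrableZl mD K I12.
apply: (@le_lt_trans _ _ (\int[mu]_(x in D)
    (K * (`|g x - step n c1 x| + `|h x - step n c2 x|)))).
  apply: le_Rintegral; first exact: mD.
  - exact: integrableR_dist mD If (integrable_step n _ n0).
  - by have := I12K; apply.
  - move=> x Dx; have [S xS] := cell_exists n x n0 Dx.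
    by rewrite fE// !(stepE n _ S)//.
rewrite RintegralZl; [|exact: mD|exact: I12].
rewrite RintegralD; [|exact: mD|exact: I1|exact: I2].
apply: (@le_lt_trans _ _ (K * (e / (2 * (K + 1)) + e / (2 * (K + 1))))).
  by rewrite ler_wpM2l// lerD// ltW.
have -> : K * (e / (2 * (K + 1)) + e / (2 * (K + 1))) = e * (K / (K + 1)).
  by field; rewrite gt_eqF// ltr_wpDl.
by rewrite gtr_pMr// ltr_pdivrMr ?ltr_wpDl// mul1r ltrDl.
Qed.

Lemma grid_approx_lim f : integrable_cube f ->
  (forall e : R, 0 < e -> exists g, [/\ integrable_cube g, grid_approx g &
    \int[mu]_(x in D) `|f x - g x| < e]) -> grid_approx f.
Proof.
move=> If fg e e0; have e20 : 0 < e / 2 by rewrite divr_gt0.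
have [g [Ig Ag fge]] := fg _ e20.
have [N H] := Ag _ e20; exists N => n Nn n0; have [c hc] := H n Nn n0.
exists c; rewrite (splitr e).
apply: le_lt_trans (ltrD fge hc).
by apply: Rintegral_dist_triangle mD If Ig (integrable_step n c n0).
Qed.

Lemma grid_approx_cst (a : R) : grid_approx (fun=> a).
Proof.
move=> e e0; exists 0%N => n _ n0; exists (fun=> a).
rewrite (@eq_Rintegral _ _ _ _ _ (fun=> 0)).
  by rewrite Rintegral_cst ?mul0r//; exact: mD.
move=> x; rewrite inE => Dx; have [S xS] := cell_exists n x n0 Dx.
by rewrite (stepE n _ S)// subrr normr0.
Qed.

(** Approximate by the cells that lie entirely in the half-space. The error is
supported by the part of the cube in the slab where the i-th coordinate is
within [1 / n] below [a]. *)
Lemma grid_approx_halfspace (i : 'I_d) (a : R) :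
  grid_approx \1_[set x : Rspace R d | (tnth x i : R) < a].
Proof.
move=> e e0; have [N Ne] : exists N : nat, e^-1 < N%:R.
  by exists (Num.truncn e^-1).+1; exact: truncnS_gt.
exists N => n Nn n0; have n0' : (0 < n%:R :> R) by rewrite ltr0n.
have ne : n%:R^-1 < e.
  by rewrite invf_plt ?posrE// (lt_le_trans Ne)// ler_nat.
pose c (S : d.-tuple 'I_n) : R := (((tnth S i).+1%:R / n%:R : R) <= a)%R%:R.
exists c; apply: le_lt_trans ne.
pose B (j : 'I_d) : set (measurableTypeR R) :=
  if j == i then `]a - n%:R^-1, a]%classic else `[0, 1[%classic.
have mB j : measurable (B j) by rewrite /B; case: ifP => _; exact: measurable_itv.
(* the slab, cut by the cube in the other directions *)
pose BB := [set t : Rspace R d | forall j, B j (tnth t j)].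
have mBB : measurable BB by exact: measurable_box.
have muBB : mu BB = (n%:R^-1)%:E.
  rewrite lebesgue_measureR_box// (bigD1 i)//= big1.
    rewrite mule1 /B eqxx lebesgue_measure_itv/= lte_fin ltrBlDr ltrDl invr_gt0 n0'.
    by rewrite -EFinB opprB addrC subrK.
  move=> j ji; rewrite /B (negbTE ji) lebesgue_measure_itv/= lte_fin ltr01.
  by rewrite oppr0 adde0.
have mH : measurable [set x : Rspace R d | (tnth x i : R) < a].
  rewrite [X in measurable X](_ : _ = setT `&`
    (fun x : Rspace R d => tnth x i) @^-1` `]-oo, a[%classic).
    exact: (measurable_tnth i measurableT (measurable_itv `]-oo, a[)).
  by apply/seteqP; split => x /=; rewrite in_itv/= => // -[].
apply: (@le_trans _ _ (\int[mu]_(x in D) \1_BB x)).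
  apply: le_Rintegral; first exact: mD.
  - exact: integrableR_dist mD (integrable_indic_cube _ mH) (integrable_step n _ n0).
  - exact: (integrable_indic_cube _ mBB).
  move=> x Dx; have [S xS] := cell_exists n x n0 Dx.
  rewrite (stepE n _ S)// /c !indicE.
  have := xS i; rewrite /bin/= in_itv/= => /andP[x1 x2].
  have [xa|xa] := ltP (tnth x i : R) a; last first.
    rewrite memNset/=; last by apply/negP; rewrite -leNgt.
    have /negbTE -> : ~~ ((tnth S i).+1%:R / n%:R <= a).
      by rewrite -ltNge (le_lt_trans xa).
    by rewrite subrr normr0.
  rewrite mem_set//; have [Sa|Sa] := leP _ a; first by rewrite subrr normr0.
  rewrite subr0 normr1 mem_set// => j; rewrite /B.
  case: eqP => [->|_]; rewrite /= in_itv/=; last exact: Dx.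
  rewrite (ltW xa) andbT ltrBlDr (lt_le_trans Sa)//.
  by rewrite -natr1 mulrDl mul1r lerD2r.
rewrite /Rintegral integral_indic//; last exact: mD.
have -> : n%:R^-1 = fine (mu BB) by rewrite muBB.
apply: fine_le.
- rewrite ge0_fin_numE//; apply: le_lt_trans (mu_unit_cube_lty (R:=R) (d:=d)).
  apply: le_measure; rewrite ?inE; [|exact: mD|by move=> x []].
  by apply: measurableI => //; exact: mD.
- by rewrite muBB.
by apply: le_measure; rewrite ?inE//; apply: measurableI => //; exact: mD.
Qed.

End grid_approx.

Section grid_dense.
Context {R : realType} {d : nat}.
Local Notation mu := (lebesgue_measureR R d).
Local Notation D := (unit_cube R d).
Local Notation mD := (@measurable_unit_cube R d).
Implicit Types (f g h : Rspace R d -> R) (A : set (Rspace R d)).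

Local Notation integrable_cube f := (mu.-integrable D (EFin \o f)).
Local Notation indic_approx A :=
  (measurable A /\ grid_approx (\1_A : Rspace R d -> R)).

Lemma grid_approx_indicC A : indic_approx A -> indic_approx (~` A).
Proof.
move=> [mA AA]; have mAC : measurable (~` A) by exact: measurableC.
split=> //; apply: (grid_approx_lipschitz (fun a _ => 1 - a) 1 _ \1_A \1_A) => //.
- move=> a b a' b'; rewrite mul1r (_ : 1 - a - (1 - a') = - (a - a')); last ring.
  by rewrite normrN lerDl.
- exact: integrable_indic_cube.
- exact: integrable_indic_cube.
- exact: integrable_indic_cube.
- by move=> x _; rewrite !indicE in_setC; case: (_ \in _); rewrite /= ?subrr ?subr0.
Qed.

Lemma grid_approx_indicU A A' :
  indic_approx A -> indic_approx A' -> indic_approx (A `|` A').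
Proof.
move=> [mA AA] [mA' AA']; have mU : measurable (A `|` A') by exact: measurableU.
split=> //; apply: (grid_approx_lipschitz Num.max 1 _ \1_A \1_A') => //.
- move=> a b a' b'; rewrite mul1r.
  have := ler_norm (a - a'); have := ler_norm (b - b').
  have := ler_norm (- (a - a')); have := ler_norm (- (b - b')).
  rewrite !normrN ler_norml.
  by have [ab|ab] := leP a b; have [ab'|ab'] := leP a' b' => *; lra.
- exact: integrable_indic_cube.
- exact: integrable_indic_cube.
- exact: integrable_indic_cube.
- move=> x _; rewrite !indicE in_setU.
  by do 2 case: (_ \in _) => /=; rewrite /Order.max ?ltxx ?ltr01 ?ltr10.
Qed.

(** Finite unions are maxima of indicators; what a finite union misses of the
countable one has a measure that tends to 0, by continuity from above. *)
Lemma grid_approx_indic_bigcup (F : (set (Rspace R d))^nat) :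
  (forall n, indic_approx (F n)) -> indic_approx (\bigcup_n F n).
Proof.
move=> HF; have mF n : measurable (F n) by case: (HF n).
set U := \bigcup_n F n; have mU : measurable U by exact: bigcupT_measurable.
split=> //; apply: grid_approx_lim; first exact: integrable_indic_cube.
move=> e e0; pose V n := \big[setU/set0]_(i < n) F i.
have V_approx n : indic_approx (V n).
  rewrite /V; elim: n => [|n ih]; last first.
    by rewrite big_ord_recr/=; exact: grid_approx_indicU.
  by rewrite big_ord0; split=> //; rewrite indic0; exact: grid_approx_cst.
have VU n : V n `<=` U by exact: bigsetU_bigcup.
pose G n := D `&` (U `\` V n).
have mG n : measurable (G n).
  by apply: measurableI; [exact: mD|apply: measurableD => //; case: (V_approx n)].
have G_cap : \bigcap_n G n = set0.
  rewrite -subset0 => x Gx; have [_ [[k _ Fx] _]] := Gx 0%N I.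
  have [_ [_ nV]] := Gx k.+1 I; apply: nV.
  by rewrite /V -bigcup_mkord; exists k => /=.
have G_oo n : (mu (G n) < +oo)%E.
  apply: le_lt_trans (mu_unit_cube_lty (R:=R) (d:=d)).
  by apply: le_measure; rewrite ?inE//; [exact: mD|move=> x []].
have : mu \o G @ \oo --> mu (\bigcap_n G n).
  apply: nonincreasing_cvg_mu; [exact: G_oo|exact: mG|by rewrite G_cap|].
  move=> m n mn; apply/subsetPset => x [Dx [Ux nVx]]; split => //; split => //.
  by apply: contra_not nVx; exact: subset_bigsetU.
rewrite G_cap measure0 => /fine_cvgP[_ /cvgr0Pnorm_lt/(_ _ e0)[N _ HN]].
exists \1_(V N); split; first by apply: integrable_indic_cube; case: (V_approx N).
  by case: (V_approx N).
apply: le_lt_trans (HN N (leqnn N)).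
rewrite (_ : \int[mu]_(x in D) _ = \int[mu]_(x in D) \1_(U `\` V N) x).
  rewrite /Rintegral integral_indic; [|exact: mD|].
    by rewrite setIC ler_norm.
  by apply: measurableD => //; case: (V_approx N).
apply: eq_Rintegral => x _; rewrite !indicE in_setD.
have [Vx|Vx] := boolP (x \in V N); last by rewrite andbT subr0 ger0_norm.
rewrite (_ : x \in U) ?andbF ?subrr ?normr0//.
exact/mem_set/(VU N)/set_mem.
Qed.

Lemma sigma_algebra_indic_approx :
  sigma_algebra setT [set A | indic_approx A].
Proof.
split.
- by split=> //; rewrite indic0; exact: grid_approx_cst.
- by move=> A HA /=; rewrite setTD; exact: grid_approx_indicC.
- exact: grid_approx_indic_bigcup.
Qed.

(** For a fixed coordinate, the good sets [B] form a sigma-algebra, and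
half-lines generate the Borel sets. *)
Lemma grid_approx_indic_coord (i : 'I_d) (B : set (measurableTypeR R)) :
  measurable B -> indic_approx ((fun x : Rspace R d => tnth x i) @^-1` B).
Proof.
have [C0 CC CU] := sigma_algebra_indic_approx.
move=> mB; have : <<s @RGenInftyO.G R >> (B : set R).
  have := mB.
  rewrite -[X in X -> _]/((@lebesgue_stieltjes_measure.ocitv R).-sigma.-measurable B).
  by rewrite RGenInftyO.measurableE.
move: B {mB}.
apply: (smallest_sub (X := [set B |
    indic_approx ((fun x : Rspace R d => tnth x i) @^-1` B)])).
  split=> [|A HA|F HF].
  - by rewrite /= preimage_set0.
  - by have := CC _ HA; rewrite /= !setTD preimage_setC.
  - by rewrite /= preimage_bigcup; exact: CU.
move=> _ [a ->] /=; split.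
  by rewrite -[X in measurable X]setTI; apply: measurable_tnth => //;
    exact: measurable_itv.
rewrite (_ : _ @^-1` _ = [set x : Rspace R d | (tnth x i : R) < a]).
  exact: grid_approx_halfspace.
by apply/seteqP; split => x /=; rewrite in_itv.
Qed.

(** The sigma-algebra of tuples is generated by the preimages under the
coordinates. *)
Lemma grid_approx_indic A : measurable A -> grid_approx (\1_A : Rspace R d -> R).
Proof.
move=> mA; suff: indic_approx A by case.
move: A mA; apply: smallest_sub; first exact: sigma_algebra_indic_approx.
move=> A; rewrite -bigcup_seq => -[i _ [B mB <-]]; rewrite setTI.
exact: grid_approx_indic_coord.
Qed.

Lemma grid_approx_sum (I : Type) (s : seq I) (F : I -> Rspace R d -> R) :
  (forall i, integrable_cube (F i) /\ grid_approx (F i)) ->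
  integrable_cube (fun x => \sum_(i <- s) F i x) /\
  grid_approx (fun x => \sum_(i <- s) F i x).
Proof.
move=> HF; elim: s => [|i s [Is As]].
  under eq_fun do rewrite big_nil; split; last exact: grid_approx_cst.
  by apply: integrableR_cst; [exact: mD|exact: mu_unit_cube_lty].
have [Ii Ai] := HF i.
under eq_fun do rewrite big_cons.
have Iis : integrable_cube (fun x => F i x + \sum_(j <- s) F j x).
  by have := integrableD mD Ii Is; apply.
split => //.
apply: (grid_approx_lipschitz +%R 1 _ (F i) (fun x => \sum_(j <- s) F j x)) => //.
by move=> a b a' b'; rewrite mul1r opprD addrACA ler_normD.
Qed.

Lemma grid_approx_scaled_indic (r : R) A : measurable A ->
  integrable_cube (fun x => r * \1_A x) /\ grid_approx (fun x => r * \1_A x).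
Proof.
move=> mA; have I1 := integrable_indic_cube _ mA.
have Ir : integrable_cube (fun x => r * \1_A x).
  by have := integrableZl mD r I1; apply.
split => //.
apply: (grid_approx_lipschitz (fun a _ => r * a) `|r| _ \1_A \1_A) => //.
  by move=> a b a' b'; rewrite -mulrBr normrM ler_wpM2l// lerDl.
all: exact: grid_approx_indic.
Qed.

(** Simple functions are finite combinations of indicators and are dense. *)
Lemma grid_approx_integrable f : integrable_cube f -> grid_approx f.
Proof.
move=> If; apply: grid_approx_lim => // e e0.
have [g [Ig _ /fine_cvgP[_ /cvgr0Pnorm_lt/(_ _ e0)[N _ HN]]]] :=
  approximation_sfun_integrable mD If.
exists (g N); split; first exact: Ig.
  have -> : (g N : Rspace R d -> R) = fun x =>
      \sum_(r <- finmap.enum_fset (fset_set (range (g N)))) r * \1_(g N @^-1` [set r]) x.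
    by apply/funext => x; rewrite fimfunE fsbig_finite.
  have [] // := grid_approx_sum _ (finmap.enum_fset (fset_set (range (g N))))
    (fun r x => r * \1_(g N @^-1` [set r]) x).
  by move=> r; exact: grid_approx_scaled_indic.
by apply: le_lt_trans (HN N (leqnn N)); exact: ler_norm.
Qed.

End grid_dense.

(** * Averaging over grid cells *)

Section cell_means.
Context {R : realType} {d : nat}.
Local Notation mu := (lebesgue_measureR R d).
Local Notation D := (unit_cube R d).
Local Notation mD := (@measurable_unit_cube R d).
Implicit Types (f g h : Rspace R d -> R) (A : set (Rspace R d)).

Local Notation integrable_cube f := (mu.-integrable D (EFin \o f)).

(** [step n (cell_mean n f)] is the conditional expectation on the grid. *)
Definition cell_mean n f (S : d.-tuple 'I_n) : R :=
  (fine (mu (cell n S)))^-1 * \int[mu]_(x in cell n S) f x.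

Lemma integrable_cell n (S : d.-tuple 'I_n) f : integrable_cube f ->
  mu.-integrable (cell n S) (EFin \o f).
Proof.
move=> If; apply: integrableS If; [exact: mD|exact: measurable_cell|].
exact: cell_subset.
Qed.

Lemma fine_mu_cell n (S : d.-tuple 'I_n) : (0 < n)%N ->
  fine (mu (cell n S)) = n%:R ^- d.
Proof. by move=> n0; rewrite mu_cell. Qed.

Lemma dist_step n f (c : d.-tuple 'I_n -> R) : (0 < n)%N -> integrable_cube f ->
  \int[mu]_(x in D) `|f x - step n c x| =
  \sum_S \int[mu]_(x in cell n S) `|f x - c S|.
Proof.
move=> n0 If; rewrite (Rintegral_cells n)//.
  by apply: eq_bigr => S _; apply: eq_Rintegral => x /set_mem xS; rewrite (stepE n _ S).
exact: integrableR_dist mD If (integrable_step n c n0).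
Qed.

(** The bound [Rintegral_dist_mean] summed over the cells. With [g] equal to [f]
this says that averaging is a quasi-optimal
approximation; with [g] an average on another grid it bounds the effect of
averaging twice. *)
Lemma dist_cell_mean n f g (c : d.-tuple 'I_n -> R) : (0 < n)%N ->
  integrable_cube f -> integrable_cube g ->
  \int[mu]_(x in D) `|f x - step n (cell_mean n g) x| <=
  2 * (\int[mu]_(x in D) `|f x - step n c x|) + \int[mu]_(x in D) `|f x - g x|.
Proof.
move=> n0 If Ig; rewrite !dist_step// (Rintegral_cells n (fun x => `|f x - g x|))//.
  rewrite mulr_sumr -big_split/=; apply: ler_sum => S _.
  apply: Rintegral_dist_mean; [exact: measurable_cell| |exact: integrable_cell..].
  by rewrite fine_mu_cell// invr_eq0 expf_neq0// pnatr_eq0 -lt0n.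
exact: integrableR_dist mD If Ig.
Qed.

Lemma dist_cell_mean_self n f (c : d.-tuple 'I_n -> R) : (0 < n)%N ->
  integrable_cube f ->
  \int[mu]_(x in D) `|f x - step n (cell_mean n f) x| <=
  2 * (\int[mu]_(x in D) `|f x - step n c x|).
Proof.
move=> n0 If; apply: (le_trans (dist_cell_mean _ _ _ c n0 If If)).
rewrite (@eq_Rintegral _ _ _ _ _ (fun=> 0) (fun x => `|f x - f x|)).
  by rewrite Rintegral_cst ?mul0r ?addr0//; exact: mD.
by move=> x _; rewrite subrr normr0.
Qed.

Lemma Rintegral_step_cell k n (a : d.-tuple 'I_k -> R) (T : d.-tuple 'I_n) :
  \int[mu]_(x in cell n T) step k a x =
  \sum_S a S * fine (mu (cell k S `&` cell n T)).
Proof.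
have mT : measurable (cell n T : set (Rspace R d)) by exact: measurable_cell.
have I1 (S : d.-tuple 'I_k) : mu.-integrable (cell n T)
    (fun x => (\1_(cell k S) x)%:E).
  exact: (integrable_cell _ _ _ (integrable_indic_cube _ (measurable_cell k S))).
rewrite /Rintegral /step; under eq_integral do rewrite -sumEFin.
rewrite integral_sum//; last first.
  by move=> S; have := integrableZl mT (a S) (I1 S); apply.
rewrite (eq_bigr (fun S => (a S * fine (mu (cell k S `&` cell n T)))%:E)).
  by rewrite sumEFin.
move=> S _; under eq_integral do rewrite EFinM.
rewrite integralZl// integral_indic//; last exact: measurable_cell.
rewrite EFinM fineK// ge0_fin_numE//.
apply: le_lt_trans (mu_unit_cube_lty (R:=R) (d:=d)).
apply: le_measure; rewrite ?inE//.
- by apply: measurableI => //; exact: measurable_cell.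
- exact: mD.
- by move=> x [+ _]; exact: cell_subset.
Qed.

End cell_means.

(** * Averages in Tucker form *)

Section tucker_form.
Context {R : realType} {d : nat}.
Local Notation mu := (lebesgue_measureR R d).
Local Notation D := (unit_cube R d).
Local Notation mD := (@measurable_unit_cube R d).
Local Notation integrable_cube f := (mu.-integrable D (EFin \o f)).

(** A Tucker histogram with its factors expanded on the bins: [a i s l] is the
weight of the bin [l] in the factor [p_{i,s}]. *)
Definition tucker_fun b k (W : d.-tuple 'I_k -> R) (a : 'I_d -> 'I_k -> 'I_b -> R)
    (x : Rspace R d) : R :=
  \sum_(S : d.-tuple 'I_k) W S *
    \prod_(i < d) \sum_(l < b) a i (tnth S i) l * hist_bin l (tnth x i).

(** The constant value of [tucker_fun] on a cell ([tucker_fun_cell]). *)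
Definition tucker_coef b k (W : d.-tuple 'I_k -> R)
    (a : 'I_d -> 'I_k -> 'I_b -> R) (T : d.-tuple 'I_b) : R :=
  \sum_(S : d.-tuple 'I_k) W S *
    \prod_(i < d) (a i (tnth S i) (tnth T i) * b%:R).

Lemma hist_bin_sum b (l : 'I_b) (c : 'I_b -> R) (x : R) :
  (0 < b)%N -> bin b l x -> \sum_j c j * hist_bin j x = c l * b%:R.
Proof.
move=> b0 lx; rewrite (bigD1 l)//= big1 ?addr0.
  by rewrite /hist_bin indicE mem_set// mulr1.
move=> j jl; rewrite /hist_bin indicE memNset ?mulr0// => jx.
by move/eqP: jl; apply; apply/val_inj; exact: bin_inj b0 jx lx.
Qed.

Lemma tucker_fun_cell b k W (a : 'I_d -> 'I_k -> 'I_b -> R) T x :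
  (0 < b)%N -> cell b T x -> tucker_fun b k W a x = tucker_coef b k W a T.
Proof.
move=> b0 xT; apply: eq_bigr => S _; congr (_ * _); apply: eq_bigr => i _.
by rewrite (hist_bin_sum _ (tnth T i)).
Qed.

Lemma tucker_fun_step b k W (a : 'I_d -> 'I_k -> 'I_b -> R) x :
  (0 < b)%N -> D x -> tucker_fun b k W a x = step b (tucker_coef b k W a) x.
Proof.
move=> b0 Dx; have [T xT] := cell_exists b x b0 Dx.
by rewrite (stepE b _ T)// (tucker_fun_cell _ _ _ _ T).
Qed.

(** The mass that the uniform density on the bin [s] of the grid of size [k]
gives to the bin [l] of the grid of size [b]. *)
Definition bin_overlap b k (s : 'I_k) (l : 'I_b) : R :=
  k%:R * fine (lebesgue_measure (bin k s `&` bin b l : set (measurableTypeR R))).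

Lemma bin_overlap_ge0 b k s l : 0 <= bin_overlap b k s l.
Proof. by rewrite mulr_ge0// fine_ge0. Qed.

Lemma fin_num_bin_overlap b k (s : 'I_k) (l : 'I_b) :
  lebesgue_measure (bin k s `&` bin b l : set (measurableTypeR R)) \is a fin_num.
Proof.
have k0 : (0 < k)%N by exact: leq_ltn_trans (ltn_ord s).
rewrite ge0_fin_numE//; apply: (@le_lt_trans _ _
    (lebesgue_measure (bin k s : set (measurableTypeR R)))).
  apply: le_measure; rewrite ?inE//; try exact: measurable_itv.
  by apply: measurableI; exact: measurable_itv.
by rewrite lebesgue_measure_bin// ltry.
Qed.

Lemma bin_overlap_sum b k (s : 'I_k) : (0 < b)%N ->
  \sum_(l < b) bin_overlap b k s l = 1.
Proof.
move=> b0; have k0 : (0 < k)%N by exact: leq_ltn_trans (ltn_ord s).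
rewrite -mulr_sumr; set m := lebesgue_measure.
suff E : ((\sum_(l < b) fine (m (bin k s `&` bin b l)))%:E = (k%:R^-1)%:E :> \bar R)%E.
  by move: E => [->]; rewrite divff// pnatr_eq0 -lt0n.
rewrite -sumEFin -(lebesgue_measure_bin k s k0).
rewrite (eq_bigr (fun l : 'I_b => m (bin k s `&` bin b l))); last first.
  by move=> l _; rewrite fineK//; exact: fin_num_bin_overlap.
rewrite -measure_bigsetU_ord.
- congr (m _); rewrite -bigcup_seq; apply/seteqP; split => x; first by move=> [l _ []].
  move=> xs; have : (`[0, 1[%classic : set R) x by exact: bin_subset01 (ltn_ord s) _ xs.
  rewrite /= in_itv/= => /(bin_exists b x b0)[l lx].
  by exists l => //=; rewrite mem_index_enum.
- by move=> l; apply: measurableI; exact: measurable_itv.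
- apply/trivIsetP => i j _ _ /eqP ij; rewrite -subset0 => x [[_ xi] [_ xj]].
  by apply/ij/val_inj; exact: bin_inj b0 xi xj.
Qed.

Lemma mu_cell_overlap b k (S : d.-tuple 'I_k) (T : d.-tuple 'I_b) :
  fine (mu (cell k S `&` cell b T)) =
  \prod_(i < d) fine (lebesgue_measure
    (bin k (tnth S i) `&` bin b (tnth T i) : set (measurableTypeR R))).
Proof.
rewrite (_ : _ `&` _ = [set x : Rspace R d | forall i,
    (bin k (tnth S i) `&` bin b (tnth T i)) (tnth x i)]).
  rewrite (lebesgue_measureR_box (A := fun i => bin k (tnth S i) `&` bin b (tnth T i))).
    rewrite (eq_bigr (fun i => (fine (lebesgue_measure
      (bin k (tnth S i) `&` bin b (tnth T i) : set (measurableTypeR R))))%:E)).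
      by rewrite prodEFin.
    by move=> i _; rewrite fineK//; exact: fin_num_bin_overlap.
  by move=> i; apply: measurableI; exact: measurable_itv.
apply/seteqP; split => x /=; first by move=> [xS xT] i; split; [exact: xS|exact: xT].
by move=> h; split => i; case: (h i).
Qed.

(** The overlap of two cells is a box, so its volume is the product of the
overlaps of their sides: this is why averaging preserves the product form. *)
Lemma tucker_coef_cell_mean b k f : (0 < b)%N -> (0 < k)%N ->
  tucker_coef b k (fun S => \int[mu]_(x in cell k S) f x)
    (fun _ => bin_overlap b k) =
  cell_mean b (step k (cell_mean k f)).
Proof.
move=> b0 k0; apply/funext => T; rewrite /cell_mean Rintegral_step_cell// mulr_sumr.
apply: eq_bigr => S _; rewrite !fine_mu_cell// !invrK mu_cell_overlap.
rewrite big_split/= prodr_const card_ord /bin_overlap big_split/= prodr_const card_ord.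
ring.
Qed.

End tucker_form.

(** * Convex hulls of histogram bins *)

(** Peel off the first term and normalize the others by their total weight [t];
when [t = 0] all their weights vanish. *)
Lemma convex_set_sum {R : realType} {E : lmodType R} (X : set (convex_lmodType E))
    (I : Type) (s : seq I) (a : I -> R) (h : I -> E) :
  @convex_set R E X -> (forall i, X (h i)) -> (forall i, 0 <= a i) ->
  \sum_(i <- s) a i = 1 -> X (\sum_(i <- s) a i *: h i).
Proof.
move=> cX Xh; elim: s a => [|i s ih] a a0.
  by rewrite big_nil => /esym/eqP; rewrite oner_eq0.
rewrite !big_cons => a1; set t := \sum_(j <- s) a j in a1.
have t0 : 0 <= t by exact: sumr_ge0.
have [tE|tN] := eqVneq t 0.
  rewrite [X in _ + X](_ : _ = 0) ?addr0.
    by have -> : a i = 1; [rewrite -a1 tE addr0|rewrite scale1r].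
  move: tE; rewrite /t; elim: (s) => [|j r jr]; first by rewrite !big_nil.
  rewrite !big_cons => /eqP; rewrite paddr_eq0 ?sumr_ge0// => /andP[/eqP-> /eqP/jr->].
  by rewrite scale0r addr0.
have ai1 : a i <= 1 by rewrite -a1 lerDl.
have Xr : X (\sum_(j <- s) (t^-1 * a j) *: h j).
  apply: ih; first by move=> j; rewrite mulr_ge0// invr_ge0.
  by rewrite -mulr_sumr mulVf.
have /set_mem := cX _ _ (Itv01 (a0 i) ai1) (mem_set (Xh i)) (mem_set Xr).
congr (X _); rewrite /conv/=; congr (_ + _).
rewrite /unstable.onem -a1 addrAC subrr add0r scaler_sumr; apply: eq_bigr => j _.
by rewrite scalerA mulrA divff// mul1r.
Qed.

Lemma hist1P {R : realType} b (f : R -> R) : hist1 b f <->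
  exists a : 'I_b -> R, [/\ forall l, 0 <= a l, \sum_l a l = 1 &
    f = fun x => \sum_l a l * hist_bin l x].
Proof.
split.
  move: f; apply: (smallest_sub (X := [set f | exists a : 'I_b -> R,
    [/\ forall l, 0 <= a l, \sum_l a l = 1 & f = fun x => \sum_l a l * hist_bin l x]])).
    move=> g h t /set_mem[a [a0 a1 ->]] /set_mem[c [c0 c1 ->]]; apply/mem_set.
    exists (fun l => t%:num * a l + (1 - t%:num) * c l); split.
    - by move=> l; rewrite addr_ge0// mulr_ge0// subr_ge0.
    - by rewrite big_split/= -!mulr_sumr a1 c1 !mulr1 addrC subrK.
    - apply/funext => x.
      rewrite -[LHS]/(t%:num * (\sum_l a l * hist_bin l x) +
        (1 - t%:num) * (\sum_l c l * hist_bin l x)) !mulr_sumr -big_split/=.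
      by apply: eq_bigr => l _; rewrite [RHS]mulrDl !mulrA.
  move=> _ [l _ <-]; exists (fun j => (j == l)%:R); split.
  - by move=> j; case: eqP.
  - by rewrite (bigD1 l)//= eqxx big1 ?addr0// => j /negbTE ->.
  - apply/funext => x; rewrite (bigD1 l)//= eqxx mul1r big1 ?addr0// => j /negbTE ->.
    by rewrite mul0r.
move=> [a [a0 a1 ->]] X [cX hX].
rewrite (_ : (fun x => _) = \sum_l a l *: @hist_bin R b l); last first.
  by apply/funext => x; rewrite fct_sumE.
by apply: convex_set_sum => // l; apply: hX; exists l.
Qed.

(** * The minimum over Tucker histograms *)

Section tucker_min.
Context {R : realType} {d : nat}.
Local Notation mu := (lebesgue_measureR R d).
Local Notation D := (unit_cube R d).
Local Notation mD := (@measurable_unit_cube R d).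
Local Notation integrable_cube f := (mu.-integrable D (EFin \o f)).

(** One simplex for [W] and one for each pair [(i, s)]: the admissible parameters
form a compact set. *)
Definition tucker_param b k (W : d.-tuple 'I_k -> R)
    (a : 'I_d -> 'I_k -> 'I_b -> R) :=
  [/\ prob_tensor W, forall i s l, 0 <= a i s l &
      forall i s, \sum_l a i s l = 1].

Lemma tucker_histogramP b k q : tucker_histogram R d b k q <->
  exists W a, tucker_param b k W a /\ q = tucker_fun b k W a.
Proof.
split=> [[W [f [W1 hf ->]]]|[W [a [[W1 a0 a1] ->]]]].
  have /choice[a ha] (u : 'I_d * 'I_k) := (hist1P b (f u.1 u.2)).1 (hf u.1 u.2).
  exists W, (fun i s => a (i, s)); split.
    split=> //; first by move=> i s l; case: (ha (i, s)).
    by move=> i s; case: (ha (i, s)).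
  apply/funext => x; apply: eq_bigr => S _; congr (_ * _); apply: eq_bigr => i _.
  by have [_ _ /= ->] := ha (i, tnth S i).
exists W, (fun i s x => \sum_l a i s l * hist_bin l x); split=> //.
by move=> i s; apply/hist1P; exists (a i s).
Qed.

Lemma L1_distE p q r : integrable_cube p -> integrable_cube r ->
  (forall x, D x -> q x = r x) ->
  L1_dist p q = (\int[mu]_(x in D) `|p x - r x|)%:E.
Proof.
move=> Ip Ir qr; rewrite /L1_dist Lnorm1.
rewrite /Rintegral fineK; last first.
  exact: (integrable_fin_num mD (integrableR_dist mu _ _ _ mD Ip Ir)).
rewrite [RHS]integral_mkcond; apply: eq_integral => x _ /=.
rewrite /patch; case: ifPn => xD; last by rewrite normr0.
by rewrite qr//; exact: set_mem.
Qed.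

Lemma continuous_Rintegral_dist (A : set (Rspace R d)) p :
  measurable A -> (mu A < +oo)%E -> mu.-integrable A (EFin \o p) ->
  continuous (fun c : R => \int[mu]_(x in A) `|p x - c|).
Proof.
move=> mA muA Ip c; apply/cvgrPdist_lt => e e0.
have Ic r : mu.-integrable A (EFin \o (fun _ : Rspace R d => r : R)).
  exact: integrableR_cst.
have lip r r' : \int[mu]_(x in A) `|p x - r| <=
    \int[mu]_(x in A) `|p x - r'| + `|r' - r| * fine (mu A).
  rewrite -Rintegral_cst//.
  exact: (Rintegral_dist_triangle mu A p (fun=> r') (fun=> r)).
have M0 : 0 < fine (mu A) + 1 by rewrite ltr_wpDl// fine_ge0.
near=> r; apply: (@le_lt_trans _ _ (`|c - r| * fine (mu A))).
  rewrite ler_distl lerBlDr (distrC c r) lip andbT.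
  by have := lip r c; rewrite (distrC c r).
apply: (@le_lt_trans _ _ (`|c - r| * (fine (mu A) + 1))).
  by rewrite ler_wpM2l// lerDl.
rewrite -ltr_pdivlMr//; near: r.
by apply: cvgr_dist_lt => //; rewrite divr_gt0.
Unshelve. all: by end_near. Qed.

(** All parameters are gathered in one function on a finite sum type, so that
Tychonoff's theorem gives the compactness of the unit box containing them. *)
Lemma tucker_dist_min p b k : (0 < k)%N -> (0 < b)%N -> integrable_cube p ->
  exists r : R, is_minimum [set L1_dist p q | q in tucker_histogram R d b k] r%:E.
Proof.
move=> k0 b0 Ip.
pose I : eqType := (d.-tuple 'I_k + 'I_d * 'I_k * 'I_b)%type.
pose T := prod_topology (fun _ : I => R).
pose W (th : T) S := th (inl S); pose a (th : T) i s l := th (inr (i, s, l)).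
pose K : set T := [set th | tucker_param b k (W th) (a th)].
pose F (th : T) :=
  \sum_S \int[mu]_(x in cell b S) `|p x - tucker_coef b k (W th) (a th) S|.
have cth i : continuous (fun th : T => th i) by exact: proj_continuous.
have cM (f g : T -> R) : continuous f -> continuous g ->
    continuous (fun th => f th * g th).
  by move=> cf cg th; exact: cvgM (cf th) (cg th).
have closed_pre (f : T -> R) (A : set R) : continuous f -> closed A ->
    closed [set th : T | A (f th)].
  by move=> cf cA; exact: (continuous_closedP f).1.
have cF : continuous F.
  apply: continuous_big => [|S _]; first exact: add_continuous.
  move=> th; apply: (@continuous_comp _ _ _
    (fun th => tucker_coef b k (W th) (a th) S)
    (fun c : R => \int[mu]_(x in cell b S) `|p x - c|)).
    move: th; apply: continuous_big => [|S' _]; first exact: add_continuous.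
    apply: (cM); first exact: cth.
    apply: continuous_big => [|i _]; first exact: mul_continuous.
    apply: (cM (fun th => a th i (tnth S' i) (tnth S i)) (fun=> b%:R)).
      exact: cth.
    exact: cst_continuous.
  apply: continuous_Rintegral_dist; [exact: measurable_cell| |exact: integrable_cell].
  by rewrite mu_cell// ltry.
(* all the mass on one index, which exists as [k] and [b] are positive *)
have K0 : K !=set0.
  pose s0 := Ordinal k0; pose l0 := Ordinal b0.
  exists (fun u => match u with
    | inl S0 => (S0 == [tuple s0 | _ < d])%:R | inr (_, _, l) => (l == l0)%:R end).
  have sum1 (J : finType) (j : J) : \sum_i (i == j)%:R = 1 :> R.
    by rewrite (bigD1 j)//= eqxx big1 ?addr0// => i /negbTE ->.
  split.
  - by split => [S|]; [exact: ler0n|exact: sum1].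
  - by move=> i s l; exact: ler0n.
  - by move=> i s; exact: sum1.
have cK : compact K.
  apply: (@subclosed_compact _ _ [set th : T | forall i, `[0, 1]%classic (th i)]).
  - rewrite (_ : K = (\bigcap_(u in [set: I]) [set th : T | 0 <= th u]) `&`
      ((fun th : T => \sum_S W th S) @^-1` [set 1] `&`
       \bigcap_(v in [set: 'I_d * 'I_k])
         ((fun th : T => \sum_l a th v.1 v.2 l) @^-1` [set 1]))); last first.
      apply/seteqP; split => th.
        move=> [[th0 th1] a0 a1]; split; first by move=> [S0|[[i s] l]] _; [exact: th0|exact: a0].
        by split => //= v _; exact: a1.
      move=> [th0 [th1 a1]]; split; [split=> // S; exact: th0|move=> i s l; exact: th0|].
      by move=> i s; exact: (a1 (i, s)).
    apply: closedI.
      apply: closed_bigI => u _.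
      exact: (closed_pre (fun th => th u) _ (cth u) (@closed_ge _ 0)).
    apply: closedI.
      apply: (closed_pre (fun th => \sum_S W th S) _ _ (@closed_eq _ 1)).
      by apply: continuous_big => [|S _]; [exact: add_continuous|exact: cth].
    apply: closed_bigI => v _.
    apply: (closed_pre (fun th => \sum_l a th v.1 v.2 l) _ _ (@closed_eq _ 1)).
    by apply: continuous_big => [|l _]; [exact: add_continuous|exact: cth].
  - apply: (@tychonoff I (fun=> R : topologicalType) (fun=> `[0, 1]%classic)) => i.
    exact: segment_compact.
  - have le1 (J : finType) (g : J -> R) j :
        (forall j, 0 <= g j) -> \sum_j g j = 1 -> 0 <= g j <= 1.
      by move=> g0 g1; rewrite g0 -g1 (bigD1 j)//= lerDl sumr_ge0.
    move=> th [[th0 th1] a0 a1] [S0|[[i s] l]] /=; rewrite in_itv/=.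
      exact: (le1 _ (W th)).
    exact: (le1 _ (a th i s)).
have FE th : L1_dist p (tucker_fun b k (W th) (a th)) = (F th)%:E.
  rewrite (L1_distE _ _ (step b (tucker_coef b k (W th) (a th))))//.
  - by rewrite dist_step.
  - exact: integrable_step.
  - by move=> x; exact: tucker_fun_step.
have [th /set_mem Kth Fmin] := compact_EVT_min K0 cK (continuous_subspaceT cF).
exists (F th); split.
  by exists (tucker_fun b k (W th) (a th)); [apply/tucker_histogramP; exists (W th), (a th)|].
move=> _ [q /tucker_histogramP[W' [a' [Wa ->]]] <-].
pose th' : T := fun u => match u with inl S0 => W' S0 | inr (i, s, l) => a' i s l end.
have : F th <= F th' by apply: Fmin; exact/mem_set.
by rewrite -lee_fin -(FE th').
Qed.

Lemma integrable_density p : is_density p -> integrable_cube p.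
Proof.
move=> [mp p0 p1]; apply/integrableP; split; first exact/measurable_EFinP.
rewrite (eq_integral (fun x => (p x)%:E)) ?p1 ?ltry// => x /set_mem Dx.
by rewrite /= ger0_norm ?p0.
Qed.

(** The core tensor holds the masses that [p] gives to the [k ^ d] cells. *)
Lemma tucker_histogram_cell_mean p b k : (0 < b)%N -> (0 < k)%N ->
  is_density p ->
  exists2 q, tucker_histogram R d b k q & forall x, D x ->
    q x = step b (cell_mean b (step k (cell_mean k p))) x.
Proof.
move=> b0 k0 hp; have Ip := integrable_density _ hp; case: hp => [mp p0 p1].
exists (tucker_fun b k (fun S => \int[mu]_(x in cell k S) p x)
  (fun _ => bin_overlap b k)).
  apply/tucker_histogramP; do 2 eexists; split; last by [].
  split.
  - split; last by rewrite -Rintegral_cells// /Rintegral p1.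
    by move=> S; apply: Rintegral_ge0 => x /cell_subset; exact: p0.
  - by move=> *; exact: bin_overlap_ge0.
  - by move=> *; exact: bin_overlap_sum.
by move=> x Dx; rewrite tucker_fun_step// tucker_coef_cell_mean.
Qed.

End tucker_min.

Theorem lemma2p2 (R : realType) (d : nat) (hd : (0 < d)%N)
    (p : Rspace R d -> R) (hp : is_density p) :
  exists m : nat -> nat -> \bar R,
    (forall k b : nat, (0 < k)%N -> (0 < b)%N ->
      is_minimum [set L1_dist p q | q in tucker_histogram R d b k] (m k b)) /\
    m kb.1 kb.2 @[kb --> filter_prod \oo \oo] --> 0%E.
Proof.
have Ip := integrable_density _ hp.
have /choice[r rP] (kb : nat * nat) : exists r : R, (0 < kb.1)%N -> (0 < kb.2)%N ->
    is_minimum [set L1_dist p q | q in tucker_histogram R d kb.2 kb.1] r%:E.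
  have [/andP[k0 b0]|] := boolP ((0 < kb.1)%N && (0 < kb.2)%N); last first.
    by move=> N; exists 0 => k0 b0; move: N; rewrite k0 b0.
  by have [r hr] := tucker_dist_min p kb.2 kb.1 k0 b0 Ip; exists r.
exists (fun k b => (r (k, b))%:E); split; first by move=> k b k0 b0; exact: (rP (k, b)).
apply: cvg_EFin; first exact: nearW.
(* the two averagings each cost twice an approximation error *)
apply/cvgr0Pnorm_lt => e e0.
have e40 : 0 < e / 4 by rewrite divr_gt0.
have [N HN] := grid_approx_integrable _ Ip _ e40.
exists ([set k | (maxn N 1 <= k)%N], [set b | (maxn N 1 <= b)%N]).
  by split; exists (maxn N 1).
move=> [k b] [/=]; rewrite !geq_max => /andP[Nk k0] /andP[Nb b0].
have [[q0 Hq0 rE] rmin] := rP (k, b) k0 b0.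
have [ck hk] := HN k Nk k0; have [cb hb] := HN b Nb b0.
have [q Hq qE] := tucker_histogram_cell_mean p b k b0 k0 hp.
have Ik := integrable_step k (cell_mean k p) k0.
have Ib := integrable_step b (cell_mean b (step k (cell_mean k p))) b0.
have r0 : 0 <= r (k, b) by rewrite -lee_fin -rE Lnorm_ge0.
rewrite ger0_norm//; apply: (@le_lt_trans _ _
    (\int[lebesgue_measureR R d]_(x in unit_cube R d)
      `|p x - step b (cell_mean b (step k (cell_mean k p))) x|)).
  rewrite -lee_fin -(L1_distE p q)//; apply: rmin; by exists q.
apply: (le_lt_trans (dist_cell_mean _ _ _ cb b0 Ip Ik)).
have -> : e = 2 * (e / 4) + 2 * (e / 4) by lra.
apply: ltrD; first by rewrite ltr_pM2l.
by apply: (le_lt_trans (dist_cell_mean_self _ _ ck k0 Ip)); rewrite ltr_pM2l.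
Qed.
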